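(* Let $H$ be a $k\times k$ matrix-weighted graph on $n$ vertices that is $\gamma$-almost regular. Then for any $\zeta\in(0,1)$, the number of eigenvalues of its normalized Laplacian $N$ that lie in $(0,\zeta]$ is at most $\frac{\gamma\cdot k^2}{(1-\zeta)^2}$.
   Context: A $k\times k$ matrix-weighted graph $H=(V,E)$ with $|V|=n$ assigns to each edge $(u,v)\in E$ a vector $\phi_{uv}\in\mathbb{R}^k$, meaning the edge has matrix weight $\phi_{uv}\phi_{uv}^T$. The generalized degree of $u$ is $D_u=\sum_{v:(u,v)\in E}\phi_{uv}\phi_{uv}^T\in\mathbb{R}^{k\times k}$, and $D\in\mathbb{R}^{nk\times nk}$ is block diagonal with diagonal blocks $D_u$. Fixing an arbitrary orientation of each edge $u\to v$, the incidence vector $b_{uv}\in\mathbb{R}^{nk}$ has $\phi_{uv}$ in block $u$, $-\phi_{uv}$ in block $v$, and zeros elsewhere; the Laplacian is $L=\sum_{(u,v)\in E}b_{uv}b_{uv}^T$ and the normalized Laplacian is $N=D^{\dagger/2}LD^{\dagger/2}$ ($\dagger$ = Moore–Penrose pseudoinverse). $H$ is $\gamma$-almost regular if $\phi_{uv}^TD_u^\dagger\phi_{uv}\le\frac{\gamma k}{n}$ for every vertex $u$ and every edge $(u,v)\in E$ incident on $u$. *)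

(* Defs.v *)
From HB Require Import structures.
From mathcomp Require Import all_boot all_order all_algebra.
From mathcomp Require Import boolp classical_sets reals.
From mathcomp Require Import polyrcf complex spectral sesquilinear.
From mathcomp Require Import ring lra.

Set Implicit Arguments.
Unset Strict Implicit.
Unset Printing Implicit Defensive.

Import Order.TTheory GRing.Theory Num.Theory.
Local Open Scope ring_scope.

Section MatrixNotions.
Variable R : realType.

(* The four Penrose equations. *)
Definition is_pseudoinverse m n (A : 'M[R]_(m, n)) (X : 'M[R]_(n, m)) : Prop :=
  [/\ A *m X *m A = A, X *m A *m X = X,
      (A *m X)^T = A *m X & (X *m A)^T = X *m A].

Definition pseudoinverse m n (A : 'M[R]_(m, n)) : 'M[R]_(n, m) :=
  xget 0 [set X | is_pseudoinverse A X]%classic.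

Definition psd n (A : 'M[R]_n) : Prop :=
  A^T = A /\ forall x : 'cV[R]_n, 0 <= (x^T *m A *m x) ord0 ord0.

Definition psd_sqrt n (A : 'M[R]_n) : 'M[R]_n :=
  xget 0 [set S | psd S /\ S *m S = A]%classic.

(* Number of eigenvalues of A in ]a, b], counted with algebraic multiplicity;
   rootsR lists each root once. *)
Definition num_eigenvalues_in n (A : 'M[R]_n) (a b : R) : nat :=
  (\sum_(x <- rootsR (char_poly A) | ((a < x) && (x <= b))%R)
    mup x (char_poly A))%N.

End MatrixNotions.

(* A finite simple graph on 'I_n; the vector of an edge does not depend on the
   order in which its endpoints are given, and values of edge_vec off the edge
   set are never used. *)
Record mwgraph (R : realType) (n k : nat) := MWGraph {
  edge : rel 'I_n;
  edge_vec : 'I_n -> 'I_n -> 'cV[R]_k;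
  edge_sym : symmetric edge;
  edge_irr : irreflexive edge;
  edge_vec_sym : forall u v, edge u v -> edge_vec u v = edge_vec v u
}.

Section MatrixWeightedGraph.
Variables (R : realType) (n k : nat) (H : mwgraph R n k).

Definition gen_degree (u : 'I_n) : 'M[R]_k :=
  \sum_(v < n | edge H u v) edge_vec H u v *m (edge_vec H u v)^T.

(* nk-dimensional objects are indexed by 'I_(\sum_(u < n) k), the index type of
   the library's block matrices with n blocks of size k. *)
Definition degree_mx : 'M[R]_(\sum_(u < n) k) :=
  \mxdiag_(u < n) gen_degree u.

Definition incidence (u v : 'I_n) : 'cV[R]_(\sum_(u < n) k) :=
  \mxcol_(w < n) (if w == u then edge_vec H u v
                  else if w == v then - edge_vec H u v else 0).

(* o u v means that the edge {u, v} is oriented u -> v. *)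
Definition is_orientation (o : rel 'I_n) : Prop :=
  forall u v, edge H u v -> o u v = ~~ o v u.

Definition laplacian (o : rel 'I_n) : 'M[R]_(\sum_(u < n) k) :=
  \sum_(u < n) \sum_(v < n | edge H u v && o u v)
    incidence u v *m (incidence u v)^T.

Definition normalized_laplacian (o : rel 'I_n) : 'M[R]_(\sum_(u < n) k) :=
  psd_sqrt (pseudoinverse degree_mx) *m laplacian o
    *m psd_sqrt (pseudoinverse degree_mx).

Definition almost_regular (gamma : R) : Prop :=
  forall u v, edge H u v ->
    ((edge_vec H u v)^T *m pseudoinverse (gen_degree u) *m edge_vec H u v)
      ord0 ord0 <= gamma * k%:R / n%:R.

End MatrixWeightedGraph.

(* pseudoinverse, psd_sqrt and num_eigenvalues_in are characterized below:
   existence and uniqueness make the default value 0 in xget irrelevant. *)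
Section Facts.
Variable R : realType.

Lemma is_pseudoinverse_uniq m n (A : 'M[R]_(m, n)) X Y :
  is_pseudoinverse A X -> is_pseudoinverse A Y -> X = Y.
Proof.
case=> AXA XAX sAX sXA [AYA YAY sAY sYA].
have eL : A *m X = A *m Y.
  by rewrite -{1}AYA -mulmxA -{1}sAX -sAY -trmx_mul mulmxA AXA sAY.
have eR : X *m A = Y *m A.
  by rewrite -{1}AYA !mulmxA -(mulmxA _ Y) -{1}sXA -sYA -trmx_mul -mulmxA
    (mulmxA A) AXA sYA.
by rewrite -XAX eR -mulmxA eL mulmxA YAY.
Qed.

Lemma gram_eq0 m n (A : 'M[R]_(m, n)) : A *m A^T = 0 -> A = 0.
Proof.
move=> A0; apply/matrixP => i j; rewrite mxE.
have /eqP := congr1 (fun M : 'M_m => M i i) A0.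
rewrite !mxE psumr_eq0 => [/allP/(_ j (mem_index_enum _))|l _]; rewrite !mxE.
  by rewrite -expr2 sqrf_eq0 => /eqP.
by rewrite -expr2 sqr_ge0.
Qed.

Lemma gram_unitmx m n (F : 'M[R]_(m, n)) : row_free F -> F *m F^T \in unitmx.
Proof.
move=> Ff; rewrite -row_free_unit -kermx_eq0; apply/eqP.
have K0 := mulmx_ker (F *m F^T); move: (kermx _) K0 => K K0.
have : (K *m F) *m (K *m F)^T = 0 by rewrite trmx_mul !mulmxA -(mulmxA K) K0 mul0mx.
by move/gram_eq0/eqP; rewrite mulmx_free_eq0 // => /eqP.
Qed.

Lemma pseudoinverse_exists m n (A : 'M[R]_(m, n)) :
  exists X, is_pseudoinverse A X.
Proof.
have FU := gram_unitmx (row_base_free A).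
have CU : (col_base A)^T *m col_base A \in unitmx.
  rewrite -{2}(trmxK (col_base A)); apply: gram_unitmx.
  by rewrite /row_free mxrank_tr; exact: col_base_full.
have AE := esym (mulmx_base A).
move: (col_base A) (row_base A) AE FU CU; move: (\rank A) => r C F AE FU CU.
pose P := invmx (F *m F^T); pose Q := invmx (C^T *m C).
have PT : P^T = P by rewrite /P trmx_inv trmx_mul trmxK.
have QT : Q^T = Q by rewrite /Q trmx_inv trmx_mul trmxK.
have eAX : A *m (F^T *m P *m Q *m C^T) = C *m Q *m C^T.
  by rewrite AE !mulmxA -(mulmxA C F) -(mulmxA C _ P) mulmxV // mulmx1.
have eXA : (F^T *m P *m Q *m C^T) *m A = F^T *m P *m F.
  by rewrite AE !mulmxA -(mulmxA _ C^T C) -(mulmxA _ Q) mulVmx // mulmx1.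
exists (F^T *m P *m Q *m C^T); split.
- by rewrite eAX AE !mulmxA -(mulmxA _ C^T C) -(mulmxA _ Q) mulVmx // mulmx1.
- by rewrite eXA !mulmxA -(mulmxA _ F F^T) -(mulmxA _ _ P) mulmxV // mulmx1.
- by rewrite eAX !trmx_mul trmxK QT mulmxA.
- by rewrite eXA !trmx_mul trmxK PT mulmxA.
Qed.

Lemma pseudoinverseP m n (A : 'M[R]_(m, n)) :
  is_pseudoinverse A (pseudoinverse A).
Proof. by have [X /xgetI] := pseudoinverse_exists A; apply. Qed.

Lemma psd_gram m n (B : 'M[R]_(m, n)) : psd (B *m B^T).
Proof.
split=> [|x]; first by rewrite trmx_mul trmxK.
rewrite mulmxA -mulmxA -[B in x^T *m B]trmxK -trmx_mul mxE.
by apply: sumr_ge0 => i _; rewrite !mxE -expr2 sqr_ge0.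
Qed.

Lemma quad_ge0 (a b : R) :
  0 <= b -> 0 <= a -> (forall t, 0 <= t * (2 * a + t * b)) -> a = 0.
Proof.
move=> b0 age0 H; have b1 : 0 < b + 1 by lra.
have := H (- a / (b + 1)).
have -> : - a / (b + 1) * (2 * a + - a / (b + 1) * b) =
    - (a ^+ 2 * (b + 2) / (b + 1) ^+ 2) by field; lra.
rewrite oppr_ge0 pmulr_lle0 ?invr_gt0 ?exprn_gt0 // pmulr_lle0; last by lra.
by move=> h; apply/eqP; rewrite -sqrf_eq0 eq_le h sqr_ge0.
Qed.

Lemma psd_ker n (S : 'M[R]_n) (x : 'cV_n) :
  psd S -> (x^T *m S *m x) ord0 ord0 = 0 -> S *m x = 0.
Proof.
move=> [sS Sge0] x0; pose y := S *m x.
pose a : R := (y^T *m y) ord0 ord0; pose b : R := (y^T *m S *m y) ord0 ord0.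
have H t : 0 <= t * (2 * a + t * b).
  have := Sge0 (x + t *: y).
  have -> : (x + t *: y)^T *m S *m (x + t *: y) =
    x^T *m S *m x + t *: (y^T *m y) + t *: (y^T *m y) + (t * t) *: (y^T *m S *m y).
    have -> : (x + t *: y)^T = x^T + t *: y^T by apply/matrixP => i j; rewrite !mxE.
    rewrite !(mulmxDl, mulmxDr) -!(scalemxAl, scalemxAr).
    rewrite -!mulmxA -/y scalerA !mulmxA.
    have -> : x^T *m S = y^T by rewrite /y trmx_mul sS.
    by rewrite !addrA.
  rewrite !mxE in x0 *; rewrite x0 -/a.
  have -> : \sum_j y^T ord0 j * y j ord0 = a by rewrite /a mxE.
  have -> : \sum_j (y^T *m S) ord0 j * y j ord0 = b by rewrite /b mxE.
  by lra.
have b0 : 0 <= b by exact: Sge0.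
have a0 : a = 0.
  apply: (quad_ge0 b0 _ H).
  by rewrite /a mxE sumr_ge0 // => i _; rewrite mxE -expr2 sqr_ge0.
apply: trmx_inj; rewrite trmx0; apply: gram_eq0; rewrite trmxK.
by apply/matrixP => i j; rewrite !ord1 [RHS]mxE.
Qed.

Lemma psd_sqrt_uniq n (S T : 'M[R]_n) :
  psd S -> psd T -> S *m S = T *m T -> S = T.
Proof.
move=> pS pT eST; apply/eqP; rewrite -subr_eq0; apply/eqP.
set d := S - T; have dT : d^T = d.
  by rewrite /d linearB /= (proj1 pS) (proj1 pT).
have h0 : S *m d + d *m T = 0.
  by rewrite /d mulmxBr mulmxBl eST addrA subrK subrr.
have ge P i : psd P -> 0 <= (d *m P *m d) i i.
  case=> _ /(_ (col i d)); congr (_ <= _).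
  rewrite tr_col dT -row_mul; rewrite [in LHS]mxE [in RHS]mxE.
  by apply: eq_bigr => j _; rewrite !mxE.
have t0 : \tr (d *m S *m d) + \tr (d *m T *m d) = 0.
  rewrite -mulmxA [X in _ + X]mxtrace_mulC mulmxA [X in _ + X]mxtrace_mulC.
  rewrite [X in _ + X]mxtrace_mulC -mulmxA -linearD /= -mulmxDr h0.
  by rewrite mulmx0 linear0.
have trge P : psd P -> 0 <= \tr (d *m P *m d).
  by move=> pP; apply: sumr_ge0 => i _; exact: ge.
have kill P : psd P -> \tr (d *m P *m d) = 0 -> P *m d = 0.
  move=> pP /eqP; rewrite psumr_eq0 => [/allP z|i _]; last exact: ge.
  apply/matrixP => i j.
  have /matrixP/(_ i ord0) : P *m col j d = 0.
    apply: psd_ker => //; have /eqP <- := z j (mem_index_enum _).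
    rewrite tr_col dT -row_mul; rewrite [in LHS]mxE [in RHS]mxE.
    by apply: eq_bigr => l _; rewrite !mxE.
  by rewrite !mxE => h; rewrite -[RHS]h; apply: eq_bigr => l _; rewrite !mxE.
have trS := trge _ pS; have trT := trge _ pT.
have Sd : S *m d = 0 by apply: kill => //; lra.
have Td : T *m d = 0 by apply: kill => //; lra.
by apply: gram_eq0; rewrite dT {1}/d mulmxBl Sd Td subrr.
Qed.

Lemma interpolation (f : R -> R) (s : seq R) :
  exists q : {poly R}, forall x, x \in s -> q.[x] = f x.
Proof.
elim: s => [|x s [q qf]]; first by exists 0.
have [xs|xs] := boolP (x \in s).
  by exists q => y; rewrite inE => /orP[/eqP ->|]; exact: qf.
pose p := \prod_(y <- s) ('X - y%:P).
have px : p.[x] != 0 by rewrite -[_ == _]/(root p x) root_prod_XsubC.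
exists (q + ((f x - q.[x]) / p.[x]) *: p) => y; rewrite inE hornerD hornerZ.
case/orP => [/eqP ->|ys]; first by rewrite divfK // addrC subrK.
have /eqP -> : root p y by rewrite root_prod_XsubC.
by rewrite mulr0 addr0 qf.
Qed.

Local Notation toC := (real_complex R).

Lemma psd_sqrt_exists n (A : 'M[R]_n) :
  psd A -> exists S, psd S /\ S *m S = A.
Proof.
case: n A => [|n] A [sA Age0].
  by exists A; split => //; apply/matrixP => -[].
pose AC := map_mx toC A.
have conjr x : Num.conj (toC x) = toC x by apply/CrealP/complex_realP; exists x.
have hA : AC \is hermsymmx.
  apply/is_hermitianmxP; rewrite expr0 scale1r; apply/matrixP => i j.
  by rewrite !mxE conjr -[in LHS]sA mxE.
have /hermitian_normalmx/orthomx_spectralP := hA.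
have /mxOverP := hermitian_spectral_diag_real hA.
have := spectral_unitarymx AC.
move: (spectralmx AC) (spectral_diag AC) => U d UU dreal ACE.
have Uu := unitarymx_unit UU.
have rowA i : row i U *m AC = d ord0 i *: row i U.
  rewrite -row_mul ACE -!mulmxA mulKVmx // row_mul row_diag_mx.
  by rewrite -scalemxAl -rowE.
pose r i := complex.Re (d ord0 i).
have dE i : d ord0 i = toC (r i).
  by have /complex_realP[y dy] := dreal ord0 i; rewrite /r dy.
have r_ge0 i : 0 <= r i.
  have : eigenvalue AC (toC (r i)).
    apply/eigenvalueP; exists (row i U); first by rewrite rowA dE.
    apply/negP => /eqP Ui0; have := congr1 (mulmx^~ (invmx U)) Ui0.
    rewrite -row_mul mulmxV // mul0mx => /matrixP/(_ ord0 i).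
    by rewrite !mxE eqxx => /eqP; rewrite oner_eq0.
  rewrite eigenvalue_root_char -map_char_poly fmorph_root.
  rewrite -eigenvalue_root_char => /eigenvalueP[v vA v0].
  have := Age0 v^T; rewrite trmxK vA -scalemxAl mxE.
  have vv : 0 <= (v *m v^T) ord0 ord0.
    by rewrite mxE sumr_ge0 // => j _; rewrite mxE -expr2 sqr_ge0.
  have vvn : (v *m v^T) ord0 ord0 != 0.
    apply: contra v0 => /eqP z; apply/eqP/gram_eq0.
    by apply/matrixP => a b; rewrite !ord1 z mxE.
  by rewrite pmulr_lge0 // lt_def vvn.
have [q qE] := interpolation (fun x => Num.sqrt (Num.sqrt x)) (codom r).
pose B := horner_mx A q.
have BT : B^T = B.
  rewrite /B; elim/poly_ind: (q) => [|p c IH]; first by rewrite rmorph0 trmx0.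
  rewrite rmorphD rmorphM /= horner_mx_X horner_mx_C linearD /= tr_scalar_mx.
  rewrite trmx_mul IH sA; congr (_ + _).
  by apply: comm_mx_horner.
have rowp i p : row i U *m horner_mx AC p = p.[d ord0 i] *: row i U.
  elim/poly_ind: p => [|p c IH]; first by rewrite rmorph0 mulmx0 horner0 scale0r.
  rewrite rmorphD rmorphM /= horner_mx_X horner_mx_C mulmxDr mulmxA IH.
  by rewrite -scalemxAl rowA scalerA mul_mx_scalar -scalerDl !hornerE.
have p0 : horner_mx A (q ^+ 4 - 'X) = 0.
  apply: (@map_mx_inj _ _ toC); rewrite map_horner_mx map_mx0 -/AC.
  rewrite -[LHS](mulKmx Uu); rewrite -[RHS](mulmx0 _ (invmx U)).
  congr (_ *m _); apply/row_matrixP => i.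
  rewrite row_mul rowp row0 dE horner_map /= hornerD hornerN hornerX horner_exp.
  rewrite qE ?codom_f // (exprM _ 2 2) !sqr_sqrtr ?sqrtr_ge0 //.
  by rewrite subrr rmorph0 scale0r.
exists (B *m B); split; first by rewrite -{2}BT; exact: psd_gram.
apply/eqP; rewrite -subr_eq0; apply/eqP; rewrite -[RHS]p0.
by rewrite rmorphB rmorphXn /= horner_mx_X -/B (exprM _ 2 2) !expr2.
Qed.

Lemma psd_sqrtP n (A : 'M[R]_n) :
  psd A -> psd (psd_sqrt A) /\ psd_sqrt A *m psd_sqrt A = A.
Proof.
by move=> /psd_sqrt_exists[S hS];
  exact: (@xgetI _ 0 [set T | psd T /\ T *m T = A]%classic S hS).
Qed.

Lemma psd_pseudoinverse n (A : 'M[R]_n) : psd A -> psd (pseudoinverse A).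
Proof.
move=> [sA Age0]; have pX := pseudoinverseP A; set X := pseudoinverse A in pX *.
have XT : X^T = X.
  apply: (is_pseudoinverse_uniq _ pX); case: pX => AXA XAX sAX sXA; split.
  - by apply: trmx_inj; rewrite !trmx_mul trmxK sA mulmxA AXA.
  - by apply: trmx_inj; rewrite !trmx_mul !trmxK sA mulmxA XAX.
  - by rewrite trmx_mul trmxK sA -sXA trmx_mul sA.
  - by rewrite trmx_mul trmxK sA -sAX trmx_mul sA.
split=> // x; case: pX => _ <- _ _.
have := Age0 (X *m x).
by rewrite trmx_mul XT !mulmxA.
Qed.

Lemma num_eigenvalues_inE n (A : 'M[R]_n) (s : seq R) a b :
  char_poly A = \prod_(x <- s) ('X - x%:P) ->
  num_eigenvalues_in A a b = count (fun x => (a < x) && (x <= b)) s.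
Proof.
rewrite /num_eigenvalues_in => ->; set p := \prod_(x <- s) _.
have p0 : p != 0 by rewrite monic_neq0 // monic_prod_XsubC.
have ur : uniq (rootsR p) by exact: uniq_roots.
have pE x : (x \in rootsR p) = (x \in s).
  by rewrite -roots_on_rootsR // inE /= root_prod_XsubC.
rewrite (perm_big (undup s)) /=; last first.
  by apply: uniq_perm => // [|x]; rewrite ?undup_uniq // mem_undup pE.
rewrite -sum1_count -[RHS]big_undup_iterop_count /=.
apply: eq_bigr => x _; rewrite mu_prod_XsubC.
by rewrite Monoid.iteropE iter_addn_0 mul1n.
Qed.

Lemma psd_degree_mx n k (H : mwgraph R n k) : psd (degree_mx H).
Proof.
have pD u : psd (gen_degree H u).
  split=> [|x].
    by rewrite /gen_degree raddf_sum; apply: eq_bigr => v _; rewrite /= trmx_mul trmxK.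
  rewrite /gen_degree mulmx_sumr mulmx_suml summxE sumr_ge0 // => v _.
  by case: (psd_gram (edge_vec H u v)) => _; apply.
split=> [|x].
  by rewrite /degree_mx tr_mxdiag; apply: eq_mxdiag => u; case: (pD u).
rewrite -[x]submxcolK tr_mxcol /degree_mx mul_mxrow_mxdiag mul_mxrow_mxcol.
by rewrite summxE sumr_ge0 // => u _; case: (pD u) => _; apply.
Qed.
End Facts.

(* Main.v *)
(** Write N = P - M with P = S D S and M = S A S, where S is the square root of
    the pseudoinverse D+ and A = D - L is the block adjacency matrix. P is idempotent with P N = N,
    so tr P = rank P is at least the number of nonzero eigenvalues of N and
      tr M^2 = tr P - 2 tr N + tr N^2 >= sum of (1 - r)^2 over the eigenvalues r <> 0 of N,
    in which every r in (0, zeta] contributes at least (1 - zeta)^2. Conversely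
      tr M^2 = tr (D+ A D+ A)
             = sum over ordered edges (u, v) of (phi^T D_u+ phi) (phi^T D_v+ phi).
    Almost regularity bounds the second factor by gamma k / n, and for fixed u
    the first factors add up to tr (D_u+ D_u) = rank D_u <= k. *)
Require Import Defs.
From mathcomp Require Import all_boot all_order all_algebra.
From mathcomp Require Import reals.
From mathcomp Require Import complex spectral sesquilinear ring lra.

Import Order.TTheory GRing.Theory Num.Theory.
Local Open Scope ring_scope.

(** * Traces, ranks and characteristic polynomials *)

Lemma mxtrace_idem (F : fieldType) n (P : 'M[F]_n) :
  P *m P = P -> \tr P = (\rank P)%:R.
Proof.
move=> PP; have cf : row_free (col_base P)^T.
  by rewrite /row_free mxrank_tr; exact: col_base_full.
have rf := row_base_free P; have PE := esym (mulmx_base P).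
move: (col_base P) (row_base P) cf rf PE; move: (\rank P) => r C F' cf rf PE.
rewrite PE mxtrace_mulC; suff -> : F' *m C = 1%:M by rewrite mxtrace1.
(* Cancelling the outer factors [C] and [F'], both of full rank, in [P *m P = P] leaves the identity
   in the middle. *)
apply: (row_free_inj rf); apply: trmx_inj; apply: (row_free_inj cf).
by rewrite -!trmx_mul mul1mx !mulmxA -PE -mulmxA -PE PP.
Qed.

(** [diag_mx e], the 0/1 diagonal of the support of [d], factors through [diag_mx d]; it is
    idempotent, so its rank is its trace, the size of the support. *)
Lemma leq_card_rank_diag_mx (F : numFieldType) n (d : 'rV[F]_n) :
  (#|[pred i | d ord0 i != 0%R]| <= \rank (diag_mx d))%N.
Proof.
pose e : 'rV[F]_n := \row_i (d ord0 i != 0)%:R.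
have eE : diag_mx e = diag_mx d *m diag_mx (\row_i (d ord0 i)^-1).
  rewrite mulmx_diag; congr diag_mx; apply/rowP => i; rewrite !mxE.
  by have [->|h] := eqVneq; rewrite ?mul0r // mulfV.
have ee : diag_mx e *m diag_mx e = diag_mx e.
  rewrite mulmx_diag; congr diag_mx; apply/rowP => i; rewrite !mxE.
  by case: (_ != _); rewrite ?mulr0 ?mulr1.
suff -> : #|[pred i | d ord0 i != 0%R]| = \rank (diag_mx e).
  by rewrite eE mxrankM_maxl.
apply/eqP; rewrite -(eqr_nat F) -mxtrace_idem // mxtrace_diag -sum1_card.
rewrite natr_sum big_mkcond /=; apply/eqP/eq_bigr => i _.
by rewrite mxE inE; case: (_ != _).
Qed.

Lemma char_poly_conj (R : comUnitRingType) n (U A : 'M[R]_n) :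
  U \in unitmx -> char_poly (invmx U *m A *m U) = char_poly A.
Proof.
move=> Uu; rewrite /char_poly /char_poly_mx.
have VU : map_mx polyC (invmx U) *m map_mx polyC U = 1%:M.
  by rewrite -map_mxM mulVmx // map_mx1.
have -> : 'X%:M - map_mx polyC (invmx U *m A *m U) =
    map_mx polyC (invmx U) *m ('X%:M - map_mx polyC A) *m map_mx polyC U.
  rewrite mulmxBr mulmxBl !map_mxM mul_mx_scalar -scalemxAl VU.
  by rewrite -mul_mx_scalar mul1mx.
by rewrite !det_mulmx mulrAC -det_mulmx VU det1 mul1r.
Qed.

(** * Spectra of real symmetric matrices *)

Section Spectrum.
Variable R : realType.
Local Notation toC := (real_complex R).

(** Over the complex numbers [A] becomes Hermitian, hence unitarily diagonalizable with real
    diagonal; each claim is checked there and pulled back along [real_complex]. *)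
Lemma symmetric_spectrum n (A : 'M[R]_n) : A^T = A ->
  exists r : 'I_n -> R,
    [/\ char_poly A = \prod_i ('X - (r i)%:P),
        \tr A = \sum_i r i,
        \tr (A *m A) = \sum_i r i ^+ 2 &
        (#|[pred i | r i != 0%R]| <= \rank A)%N].
Proof.
move=> sA; pose AC := map_mx toC A.
have conjr x : Num.conj (toC x) = toC x by apply/CrealP/complex_realP; exists x.
have hA : AC \is hermsymmx.
  apply/is_hermitianmxP; rewrite expr0 scale1r; apply/matrixP => i j.
  by rewrite !mxE conjr -[in LHS]sA mxE.
have /hermitian_normalmx/orthomx_spectralP := hA.
have /mxOverP := hermitian_spectral_diag_real hA.
have := spectral_unitarymx AC.
move: (spectralmx AC) (spectral_diag AC) => U d /unitarymx_unit Uu dreal ACE.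
pose r i := complex.Re (d ord0 i).
have dE i : d ord0 i = toC (r i).
  by have /complex_realP[y dy] := dreal ord0 i; rewrite /r dy.
exists r; split.
- apply: (map_poly_inj toC); rewrite map_char_poly -/AC ACE char_poly_conj //.
  rewrite char_poly_trig ?diag_mx_is_trig // rmorph_prod; apply: eq_bigr => i _.
  by rewrite /= map_polyXsubC mxE eqxx dE.
- apply: (fmorph_inj toC); rewrite -trace_map_mx -/AC ACE mxtrace_mulC mulKVmx //.
  by rewrite mxtrace_diag rmorph_sum; apply: eq_bigr => i _; rewrite dE.
- apply: (fmorph_inj toC); rewrite -trace_map_mx map_mxM -/AC ACE.
  rewrite !mulmxA mulmxK // -(mulmxA (invmx U)) mxtrace_mulC mulKVmx //.
  rewrite mulmx_diag mxtrace_diag rmorph_sum; apply: eq_bigr => i _.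
  by rewrite mxE dE -expr2 rmorphXn.
- rewrite -(mxrank_map toC) -/AC ACE mxrankMfree ?row_free_unit //.
  rewrite eqmxMfull ?row_full_unit ?unitmx_inv //.
  apply: leq_trans (leq_card_rank_diag_mx _ _ _); apply: eq_leq.
  by apply: eq_card => i; rewrite !inE dE fmorph_eq0.
Qed.

Lemma count_eigenvalues_le n (P N : 'M[R]_n) (zeta : R) :
  N^T = N -> P *m P = P -> P *m N = N -> zeta < 1 ->
  (num_eigenvalues_in N 0 zeta)%:R * (1 - zeta) ^+ 2
    <= \tr ((P - N) *m (P - N)).
Proof.
move=> sN PP PN z1; have [r [cN tN tN2 rN]] := symmetric_spectrum _ _ sN.
have -> : \tr ((P - N) *m (P - N)) = \tr P - 2 * \tr N + \tr (N *m N).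
  rewrite mulmxBl !mulmxBr PP PN !linearB /= (mxtrace_mulC N P) PN; ring.
have tP : #|[pred i | r i != 0%R]|%:R <= \tr P.
  rewrite mxtrace_idem // ler_nat (leq_trans rN) // -PN; exact: mxrankM_maxl.
rewrite (num_eigenvalues_inE (s := codom r)); last first.
  by rewrite cN codomE big_map big_enum.
(* Nonzero eigenvalues outside (0, zeta] only add squares. *)
apply: (@le_trans _ _ (\sum_(i | r i != 0) (1 - r i) ^+ 2)).
  rewrite codomE count_map -sum1_count natr_sum mulr_suml big_enum_cond /=.
  rewrite big_mkcond [leRHS]big_mkcond ler_sum // => i _ /=.
  case: ifP => [/andP[r0 rz]|_]; last by case: ifP => // _; exact: sqr_ge0.
  by rewrite gt_eqF //= mul1r ler_sqr ?nnegrE; lra.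
(* Zero eigenvalues do not affect the traces of [N] and [N *m N]; the constant term counts the
   nonzero ones. *)
have -> : \sum_(i | r i != 0) (1 - r i) ^+ 2 =
    #|[pred i | r i != 0%R]|%:R - 2 * \tr N + \tr (N *m N).
  rewrite tN tN2 -sum1_card natr_sum !(big_mkcond (fun i => _ != _)) /=.
  rewrite big_mkcond /= mulr_sumr -sumrB -big_split /=; apply: eq_bigr => i _.
  by case: eqVneq => [->|_] /=; ring.
by rewrite !lerD2r.
Qed.

(** * Square root of the pseudoinverse *)

Section Sqrt.
Variables (n : nat) (D : 'M[R]_n).
Hypothesis psdD : psd D.
Let X := pseudoinverse D.
Let S := psd_sqrt X.

Lemma sqrt_pinv_sym : S^T = S.
Proof. by case: (psd_sqrtP (psd_pseudoinverse psdD)) => -[]. Qed.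

Lemma sqrt_pinv_sqr : S *m S = X.
Proof. by case: (psd_sqrtP (psd_pseudoinverse psdD)). Qed.

(** With Q = D X, the Gram matrix of S Q - S is Q X Q - Q X - X Q + X, which vanishes because X Q =
    X. *)
Lemma sqrt_pinv_mul : S *m (D *m X) = S.
Proof.
have [_ XDX sDX _] := pseudoinverseP D.
apply/eqP; rewrite -subr_eq0; apply/eqP; apply: trmx_inj; rewrite trmx0.
apply: gram_eq0; rewrite trmxK [(_ - _)^T]linearB /= trmx_mul sqrt_pinv_sym sDX.
have SSQ : S *m (S *m (D *m X)) = X by rewrite mulmxA sqrt_pinv_sqr mulmxA XDX.
by rewrite mulmxBl !mulmxBr -!(mulmxA (D *m X)) SSQ sqrt_pinv_sqr !subrr.
Qed.

(** This one identity makes S D S idempotent and later makes it fix the normalized Laplacian. *)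
Lemma sqrt_pinv_proj : (S *m D *m S) *m S = S.
Proof. by rewrite -mulmxA sqrt_pinv_sqr -mulmxA sqrt_pinv_mul. Qed.

Lemma sqrt_pinv_idem : (S *m D *m S) *m (S *m D *m S) = S *m D *m S.
Proof. by rewrite [LHS]mulmxA [X in X *m S]mulmxA sqrt_pinv_proj. Qed.

Lemma mxtrace_sqrt_pinv_conj (B : 'M[R]_n) :
  \tr ((S *m B *m S) *m (S *m B *m S)) = \tr ((X *m B) *m (X *m B)).
Proof.
by rewrite mulmxA mxtrace_mulC !mulmxA sqrt_pinv_sqr -(mulmxA _ S S) sqrt_pinv_sqr.
Qed.

End Sqrt.

Lemma mxtrace_pinv_mul_le n (D : 'M[R]_n) :
  \tr (pseudoinverse D *m D) <= n%:R.
Proof.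
have [_ XDX _ _] := pseudoinverseP D.
by rewrite mxtrace_idem ?mulmxA ?XDX // ler_nat rank_leq_row.
Qed.

(** * Block diagonal matrices *)

Section BlockDiagonal.
Variables n k : nat.
Implicit Types B C : 'I_n -> 'M[R]_k.

Lemma mxdiagE B :
  \mxdiag_(u < n) B u = \mxblock_(u < n, v < n) (if u == v then B u else 0).
Proof.
apply/eq_mxblock => u v; case: eqVneq => // _.
by rewrite conform_mx_id.
Qed.

Lemma mul_mxdiag B C :
  \mxdiag_(u < n) B u *m \mxdiag_(u < n) C u = \mxdiag_(u < n) (B u *m C u).
Proof.
rewrite (mxdiagE C) mul_mxdiag_mxblock mxdiagE; apply/eq_mxblock => u v.
by case: eqVneq => [->|_]; rewrite ?mulmx0.
Qed.

(** The Penrose equations hold block by block, and they determine the pseudoinverse. *)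
Lemma pseudoinverse_mxdiag B :
  pseudoinverse (\mxdiag_(u < n) B u) = \mxdiag_(u < n) pseudoinverse (B u).
Proof.
apply: (is_pseudoinverse_uniq (pseudoinverseP _)).
split; rewrite !mul_mxdiag ?tr_mxdiag; apply: eq_mxdiag => u;
  by case: (pseudoinverseP (B u)).
Qed.

End BlockDiagonal.
End Spectrum.

(** * Laplacian and adjacency matrix of the graph *)

Section Graph.
Variables (R : realType) (n k : nat) (H : mwgraph R n k).

(** The value 0 off the edges turns sums over neighbours into full sums. *)
Definition edge_weight (u v : 'I_n) : 'M[R]_k :=
  if edge H u v then edge_vec H u v *m (edge_vec H u v)^T else 0.

Definition adjacency_mx : 'M[R]_(\sum_(u < n) k) :=
  \mxblock_(u < n, v < n) edge_weight u v.

Lemma edge_weight_sym u v : edge_weight u v = edge_weight v u.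
Proof.
by rewrite /edge_weight edge_sym; case: ifP => // e; rewrite (edge_vec_sym e).
Qed.

Lemma gen_degreeE u : gen_degree H u = \sum_v edge_weight u v.
Proof. by rewrite /gen_degree big_mkcond. Qed.

(** After exchanging the sums, the terms [F v u] cover exactly the adjacent pairs oriented the other
    way, so each adjacent ordered pair is counted once. *)
Lemma sum_orientation (V : nmodType) (o : rel 'I_n) (F : 'I_n -> 'I_n -> V) :
  is_orientation H o -> (forall u v, ~~ edge H u v -> F u v = 0) ->
  \sum_u \sum_(v | edge H u v && o u v) (F u v + F v u) = \sum_u \sum_v F u v.
Proof.
move=> oH F0.
under eq_bigr => u _ do rewrite big_split /=.
rewrite big_split /= [X in _ + X](exchange_big_dep xpredT) //= -big_split /=.
apply: eq_bigr => u _; rewrite [RHS](bigID (fun v => edge H u v && o u v)) /=.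
congr (_ + _); rewrite [in RHS](bigID (fun v => edge H u v)) /=.
rewrite [X in _ = _ + X]big1 ?addr0 => [|v /andP[_ /F0]//].
apply: eq_bigl => v; rewrite (edge_sym H v u); case e: (edge H u v) => //=.
by rewrite andbT oH // edge_sym.
Qed.

Lemma laplacianE o :
  is_orientation H o -> laplacian H o = degree_mx H - adjacency_mx.
Proof.
move=> oH.
(* The rank-one term of an edge is split between its two endpoints: [F w w' u v] is the part of its
   block (w, w') in block row u. *)
pose F w w' u v : 'M[R]_k :=
  (if w == u then (if w' == u then edge_weight u v else 0) else 0) -
  (if w == u then (if w' == v then edge_weight u v else 0) else 0).
rewrite /degree_mx mxdiagE -mxblockB.
have -> : laplacian H o = \mxblock_(w < n, w' < n)
    \sum_u \sum_(v | edge H u v && o u v) (F w w' u v + F w w' v u).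
  rewrite mxblock_sum; apply: eq_bigr => u _.
  rewrite mxblock_sum; apply: eq_bigr => v /andP[e _].
  rewrite /incidence tr_mxcol mul_mxcol_mxrow; apply: eq_mxblock => w w'.
  have uv : (u == v) = false by apply: contraTF e => /eqP ->; rewrite edge_irr.
  have vu : (v == u) = false by rewrite eq_sym.
  rewrite /F (edge_weight_sym v u) /edge_weight e.
  case: (eqVneq w u) => [->|_]; case: (eqVneq w' u) => [->|_];
    rewrite ?eqxx ?uv ?vu; [|case: (w' == v)|case: (w == v)|
      case: (w == v); case: (w' == v)];
    by rewrite ?linearN /= ?trmx0 ?mulNmx ?mulmxN ?mul0mx ?mulmx0
      ?opprK ?subrr ?subr0 ?sub0r ?addr0 ?add0r ?oppr0.
apply: eq_mxblock => w w'; rewrite sum_orientation // => [|u v ne]; last first.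
  by rewrite /F /edge_weight (negbTE ne) !if_same subrr.
(* Only u = w contributes to block row w. *)
rewrite (bigD1 w) //= [X in _ + X]big1 ?addr0 => [|u uw]; last first.
  by apply: big1 => v _; rewrite /F eq_sym (negbTE uw) subrr.
rewrite /F eqxx sumrB; congr (_ - _).
  rewrite eq_sym; case: eqP => _; last by rewrite big1.
  by rewrite gen_degreeE.
rewrite (bigD1 w') //= eqxx big1 ?addr0 // => v; rewrite eq_sym => /negbTE -> //.
Qed.

Lemma mxtrace_rank1_mul (X : 'M[R]_k) (f : 'cV[R]_k) :
  \tr (X *m (f *m f^T)) = (f^T *m X *m f) ord0 ord0.
Proof. by rewrite mulmxA mxtrace_mulC mulmxA trace_mx11. Qed.

Lemma psd_gen_degree u : psd (gen_degree H u).
Proof.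
split=> [|x].
  rewrite /gen_degree raddf_sum; apply: eq_bigr => v _.
  by rewrite /= trmx_mul trmxK.
rewrite /gen_degree mulmx_sumr mulmx_suml summxE sumr_ge0 // => v _.
by case: (psd_gram (edge_vec H u v)) => _; apply.
Qed.

Lemma mxtrace_pinv_adjacency_le (gamma : R) :
  0 <= gamma -> almost_regular H gamma ->
  \tr ((pseudoinverse (degree_mx H) *m adjacency_mx) *m
       (pseudoinverse (degree_mx H) *m adjacency_mx)) <= gamma * k%:R ^+ 2.
Proof.
move=> g0 reg; set B := pseudoinverse _ *m _.
pose X u := pseudoinverse (gen_degree H u).
have -> : \tr (B *m B) =
    \sum_u \sum_v \tr (X u *m edge_weight u v *m (X v *m edge_weight v u)).
  rewrite /B pseudoinverse_mxdiag mul_mxdiag_mxblock mul_mxblock.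
  by rewrite mxtrace_mxblock; apply: eq_bigr => u _; rewrite linear_sum.
have Xge u (x : 'cV[R]_k) : 0 <= (x^T *m X u *m x) ord0 ord0.
  by have [_] := psd_pseudoinverse (psd_gen_degree u); apply.
have row_le u : \sum_v \tr (X u *m edge_weight u v *m (X v *m edge_weight v u))
    <= gamma * k%:R / n%:R * k%:R.
  apply: (@le_trans _ _ (gamma * k%:R / n%:R * \tr (X u *m gen_degree H u))).
    rewrite gen_degreeE mulmx_sumr linear_sum mulr_sumr /=.
    apply: ler_sum => v _; rewrite (edge_weight_sym v u) /edge_weight.
    case: ifP => e; last by rewrite !mulmx0 linear0 mulr0.
    set f := edge_vec H u v.
    (* The inner factor [f^T *m X v *m f] is 1 x 1 and comes out as a scalar. *)
    have -> : \tr (X u *m (f *m f^T) *m (X v *m (f *m f^T))) =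
        (f^T *m X v *m f) ord0 ord0 * \tr (X u *m (f *m f^T)).
      rewrite -mulmxA -(mulmxA f) (mulmxA f^T) (mulmxA (f^T *m X v)).
      rewrite [f^T *m X v *m f]mx11_scalar mul_scalar_mx -!scalemxAr.
      by rewrite linearZ -mx11_scalar.
    rewrite mxtrace_rank1_mul ler_wpM2r ?Xge //.
    (* Almost regularity is used at v, so the edge is read from its other end. *)
    by rewrite /f edge_vec_sym //; apply: reg; rewrite edge_sym.
  apply: ler_wpM2l (mxtrace_pinv_mul_le _ _ _).
  by rewrite !mulr_ge0 ?invr_ge0 ?ler0n.
apply: (le_trans (ler_sum _ (fun u _ => row_le u))).
rewrite sumr_const card_ord.
(* For n = 0 the division by n does not cancel, but the left side is an empty sum. *)
have [->|n0] := posnP n; first by rewrite mulr0n mulr_ge0 ?sqr_ge0.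
have {}n0 : n%:R != 0 :> R by rewrite pnatr_eq0 -lt0n.
by rewrite -[leLHS]mulr_natr le_eqVlt; apply/orP; left; apply/eqP; field.
Qed.

End Graph.

(** * The eigenvalue count *)

Theorem theorem3p15 (R : realType) (n k : nat) (H : mwgraph R n k)
    (o : rel 'I_n) (gamma zeta : R) :
  is_orientation H o ->
  0 <= gamma ->
  almost_regular H gamma ->
  0 < zeta -> zeta < 1 ->
  (num_eigenvalues_in (normalized_laplacian H o) 0 zeta)%:R
    <= gamma * k%:R ^+ 2 / (1 - zeta) ^+ 2.
Proof.
move=> oH g0 reg _ z1.
rewrite ler_pdivlMr ?exprn_gt0 ?subr_gt0 //.
have pD := psd_degree_mx H; set D := degree_mx H in pD.
set S := psd_sqrt (pseudoinverse D).
have NE : normalized_laplacian H o = S *m D *m S - S *m adjacency_mx _ _ _ H *m S.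
  by rewrite /normalized_laplacian laplacianE // mulmxBr mulmxBl.
have sL : (laplacian H o)^T = laplacian H o.
  rewrite /laplacian raddf_sum; apply: eq_bigr => u _.
  by rewrite raddf_sum; apply: eq_bigr => v _; rewrite /= trmx_mul trmxK.
apply: le_trans (count_eigenvalues_le _ _ (S *m D *m S) _ _ _ _ _ z1) _.
- by rewrite /normalized_laplacian !trmx_mul sqrt_pinv_sym // sL mulmxA.
- exact: sqrt_pinv_idem.
- by rewrite /normalized_laplacian !mulmxA sqrt_pinv_proj.
(* With P = S D S, the difference P - N is S A S, A being the adjacency matrix. *)
rewrite NE opprB addrC subrK mxtrace_sqrt_pinv_conj //.
exact: mxtrace_pinv_adjacency_le.
Qed.
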